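(* Let $n\ge 2$. The unrestricted virtual braid group $UB_n$ has the following reduced presentation, with generators $\sigma_1, v_1,\ldots,v_{n-1}$ (the elements of $UB_n$ of the same names) and defining relations: $$\begin{array}{l} v_i v_{i+1} v_i = v_{i+1} v_i v_{i+1},\\ v_i v_j = v_j v_i,\quad j\neq i\pm 1,\\ v_i^2 = 1,\quad 1\le i\le n-1,\\ \sigma_1 v_j = v_j\sigma_1,\quad j>2,\\ (v_1\sigma_1 v_1)(v_2\sigma_1 v_2)(v_1\sigma_1 v_1) = (v_2\sigma_1 v_2)(v_1\sigma_1 v_1)(v_2\sigma_1 v_2),\\ v_1(v_2\sigma_1v_2v_1\sigma_1) = (v_2\sigma_1v_2v_1\sigma_1)v_2,\\ (\sigma_1v_1v_2\sigma_1v_2)v_1 = v_2(\sigma_1v_1v_2\sigma_1v_2),\\ \sigma_1(v_2v_3v_1v_2\sigma_1v_2v_1v_3v_2) = (v_2v_3v_1v_2\sigma_1v_2v_1v_3v_2)\sigma_1. \end{array}$$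
   Context: The unrestricted virtual braid group $UB_n$ is the group with generators $\sigma_1,\ldots,\sigma_{n-1}$ (braid generators) and $v_1,\ldots,v_{n-1}$ (virtual generators) and the following relations: braid relations $\sigma_i\sigma_{i+1}\sigma_i=\sigma_{i+1}\sigma_i\sigma_{i+1}$ and $\sigma_i\sigma_j=\sigma_j\sigma_i$ for $|i-j|\ge 2$; virtual relations $v_i^2=1$, $v_iv_{i+1}v_i=v_{i+1}v_iv_{i+1}$, and $v_iv_j=v_jv_i$ for $|i-j|\ge 2$; mixed relations $\sigma_iv_j=v_j\sigma_i$ for $|i-j|\ge 2$ and $v_i\sigma_{i+1}v_i=v_{i+1}\sigma_iv_{i+1}$; both forbidden move relations $v_i\sigma_{i+1}\sigma_i=\sigma_{i+1}\sigma_iv_{i+1}$ and $\sigma_i\sigma_{i+1}v_i=v_{i+1}\sigma_i\sigma_{i+1}$. In $UB_n$ the other braid generators are expressed through the generators of the reduced presentation by $$\sigma_{i+1} = (v_i\cdots v_2v_1)(v_{i+1}\cdots v_3v_2)\,\sigma_1\,(v_2v_3\cdots v_{i+1})(v_1v_2\cdots v_i),\qquad 1\le i\le n-2.$$ In every presentation, a relation is included exactly when all indices occurring in it lie in $\{1,\ldots,n-1\}$. *)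

(* Defs.v *)
From HB Require Import structures.
From mathcomp Require Import all_boot boolp.

Set Implicit Arguments.
Unset Strict Implicit.
Unset Printing Implicit Defensive.

Local Open Scope group_scope.

Section Presentation.
Variable X : Type.

(* (x, true) stands for the generator x, (x, false) for its formal inverse. *)
Definition word := seq (X * bool).

HB.instance Definition _ := gen_eqMixin word.
HB.instance Definition _ := gen_choiceMixin word.

Definition word_inv (w : word) : word := rev [seq (l.1, ~~ l.2) | l <- w].

Variable R : word -> word -> Prop.

(* R u w is read as the defining relation u = w; pres_eq is the smallest
   congruence on words containing R and free cancellation. *)
Inductive pres_eq : word -> word -> Prop :=
| pres_eq_rel u w : R u w -> pres_eq u w
| pres_eq_cancel x b : pres_eq [:: (x, b); (x, ~~ b)] [::]
| pres_eq_cat u u' w w' : pres_eq u u' -> pres_eq w w' ->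
    pres_eq (u ++ w) (u' ++ w')
| pres_eq_refl u : pres_eq u u
| pres_eq_sym u w : pres_eq u w -> pres_eq w u
| pres_eq_trans u w z : pres_eq u w -> pres_eq w z -> pres_eq u z.

Definition pres_eqb : rel word := fun u w => `[< pres_eq u w >].

Lemma pres_eqb_equiv : equiv_class_of pres_eqb.
Proof.
split=> [u|u w|w u z].
- by apply/asboolP; apply: pres_eq_refl.
- by apply/asboolP/asboolP; apply: pres_eq_sym.
- by move=> /asboolP uw /asboolP wz; apply/asboolP; apply: pres_eq_trans uw wz.
Qed.

Canonical pres_equiv := EquivRelPack pres_eqb_equiv.

Definition pres_group := {eq_quot pres_equiv}%qT.

HB.instance Definition _ := Choice.on pres_group.

Definition pres_class (w : word) : pres_group := (\pi_({eq_quot pres_equiv}) w)%qT.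

Definition pres_gen (x : X) : pres_group := pres_class [:: (x, true)].

Let pres_repr (a : pres_group) : word := repr (a : {eq_quot pres_equiv}%qT).

Lemma pres_classP u w : pres_class u = pres_class w <-> pres_eq u w.
Proof.
split=> [/eqquotP /asboolP //|uw]; first by apply/eqquotP/asboolP.
Qed.

Let pres_reprK a : pres_class (pres_repr a) = a.
Proof. exact: reprK. Qed.

Definition pres_mul (a b : pres_group) := pres_class (pres_repr a ++ pres_repr b).
Definition pres_one : pres_group := pres_class [::].
Definition pres_inv (a : pres_group) := pres_class (word_inv (pres_repr a)).

Let pres_eq_repr w : pres_eq (pres_repr (pres_class w)) w.
Proof. by apply/pres_classP; rewrite pres_reprK. Qed.

Let pres_class_mul u w : pres_mul (pres_class u) (pres_class w) = pres_class (u ++ w).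
Proof. by apply/pres_classP; apply: pres_eq_cat. Qed.

Let word_invK : involutive word_inv.
Proof.
move=> w; rewrite /word_inv map_rev revK; elim: w => //= -[x b] w /= ->.
by rewrite negbK.
Qed.

Let word_mulV w : pres_eq (w ++ word_inv w) [::].
Proof.
elim: w => [|[x b] w IHw]; first exact: pres_eq_refl.
have -> : ((x, b) :: w) ++ word_inv ((x, b) :: w)
    = [:: (x, b)] ++ ((w ++ word_inv w) ++ [:: (x, ~~ b)]).
  by rewrite /word_inv /= rev_cons -cats1 catA.
apply: pres_eq_trans (pres_eq_cancel x b).
exact: (pres_eq_cat (pres_eq_refl [:: (x, b)]) (pres_eq_cat IHw (pres_eq_refl _))).
Qed.

Let pres_mulA : associative pres_mul.
Proof.
move=> a b c; rewrite -(pres_reprK a) -(pres_reprK b) -(pres_reprK c).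
by rewrite !pres_class_mul catA.
Qed.

Let pres_mul1 : left_id pres_one pres_mul.
Proof. by move=> a; rewrite -(pres_reprK a) pres_class_mul. Qed.

Let pres_mulr1 : right_id pres_one pres_mul.
Proof. by move=> a; rewrite -(pres_reprK a) pres_class_mul cats0. Qed.

Let pres_mulV : left_inverse pres_one pres_inv pres_mul.
Proof.
move=> a; rewrite -{2}(pres_reprK a) pres_class_mul; apply/pres_classP.
by rewrite -{2}(word_invK (pres_repr a)); apply: word_mulV.
Qed.

Let pres_mulrV : right_inverse pres_one pres_inv pres_mul.
Proof.
move=> a; rewrite -{1}(pres_reprK a) pres_class_mul; apply/pres_classP.
exact: word_mulV.
Qed.

HB.instance Definition _ := isGroup.Build pres_group
  pres_mulA pres_mul1 pres_mulr1 pres_mulV pres_mulrV.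

Lemma pres_class1 : pres_class [::] = 1.
Proof. by []. Qed.

Lemma pres_classM u w : pres_class (u ++ w) = pres_class u * pres_class w.
Proof. exact/esym/pres_class_mul. Qed.

End Presentation.

Definition word_eval (X : Type) (G : groupType) (f : X -> G) (w : word X) : G :=
  \prod_(l <- w) (if l.2 then f l.1 else (f l.1)^-1).

(* < X | R > is a presentation of G in which the generator x names the element
   f x: the isomorphism has to be the one determined by f. *)
Definition has_presentation (G : groupType) (X : Type) (f : X -> G)
    (R : word X -> word X -> Prop) : Prop :=
  exists phi : {multiplicative pres_group R -> G},
    bijective phi /\ forall x : X, phi (pres_gen R x) = f x.

Section PresentationTheory.
Variables (X : Type) (R : word X -> word X -> Prop).

Lemma pres_class_eval (w : word X) : pres_class R w = word_eval (pres_gen R) w.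
Proof.
elim: w => [|[x b] w IHw]; first by rewrite /word_eval big_nil.
rewrite -cat1s pres_classM IHw /word_eval big_cons /=; congr (_ * _).
case: b => //; apply: (mulgI (pres_gen R x)); rewrite mulgV /pres_gen -pres_classM.
by apply/pres_classP; apply: (pres_eq_cancel R x true).
Qed.

Lemma pres_group_rel u w : R u w ->
  word_eval (pres_gen R) u = word_eval (pres_gen R) w.
Proof. by move=> uw; rewrite -!pres_class_eval; apply/pres_classP/pres_eq_rel. Qed.

Lemma word_eval_pres_eq (G : groupType) (f : X -> G) u w :
    (forall u w, R u w -> word_eval f u = word_eval f w) ->
  pres_eq R u w -> word_eval f u = word_eval f w.
Proof.
move=> fR; elim=> {u w} [u w /fR //|x b|u u' w w' _ IHu _ IHw|//|u w _ -> //|].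
- by rewrite /word_eval big_cons big_seq1 big_nil; case: b; rewrite /= ?mulgV ?mulVg.
- by rewrite /word_eval !big_cat /=; congr (_ * _).
- by move=> u w z _ -> _ ->.
Qed.

Lemma pres_group_lift (G : groupType) (f : X -> G) :
    (forall u w, R u w -> word_eval f u = word_eval f w) ->
  exists phi : {multiplicative pres_group R -> G},
    forall x, phi (pres_gen R x) = f x.
Proof.
move=> fR; pose phi (a : pres_group R) : G := word_eval f (repr a)%qT.
have phiE w : phi (pres_class R w) = word_eval f w.
  by apply: word_eval_pres_eq fR _; apply/pres_classP; apply: reprK.
have phiM : {morph phi : a b / a * b}.
  move=> a b; rewrite {1}[a * b]/(pres_class R _) phiE.
  by rewrite /word_eval big_cat.
pose phi_m := isMultiplicative.Build _ _ phi phiM.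
pose Phi : {multiplicative pres_group R -> G} := HB.pack phi phi_m.
by exists Phi => x; rewrite /= phiE /word_eval big_seq1.
Qed.

End PresentationTheory.

(* Indices are not shifted: they range over 1, ..., n - 1. *)
Definition gen_idx (n : nat) := {i : nat | 0 < i < n}%N.

Definition far (i j : nat) : bool := (i.+1 < j)%N || (j.+1 < i)%N.

Inductive ub_gen (n : nat) := GSigma (i : gen_idx n) | GVirt (i : gen_idx n).

Section UBRel.
Variable n : nat.
Implicit Types i j k : gen_idx n.
Let s i : ub_gen n * bool := (GSigma i, true).
Let v i : ub_gen n * bool := (GVirt i, true).

Inductive ub_rel : word (ub_gen n) -> word (ub_gen n) -> Prop :=
| ub_braid i j : sval j = (sval i).+1 -> ub_rel [:: s i; s j; s i] [:: s j; s i; s j]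
| ub_sigma_comm i j : far (sval i) (sval j) -> ub_rel [:: s i; s j] [:: s j; s i]
| ub_virt_sq i : ub_rel [:: v i; v i] [::]
| ub_virt_braid i j : sval j = (sval i).+1 ->
    ub_rel [:: v i; v j; v i] [:: v j; v i; v j]
| ub_virt_comm i j : far (sval i) (sval j) -> ub_rel [:: v i; v j] [:: v j; v i]
| ub_mixed_comm i j : far (sval i) (sval j) -> ub_rel [:: s i; v j] [:: v j; s i]
| ub_mixed i j : sval j = (sval i).+1 ->
    ub_rel [:: v i; s j; v i] [:: v j; s i; v j]
| ub_forbidden1 i j : sval j = (sval i).+1 ->
    ub_rel [:: v i; s j; s i] [:: s j; s i; v j]
| ub_forbidden2 i j : sval j = (sval i).+1 ->
    ub_rel [:: s i; s j; v i] [:: v j; s i; s j].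

Definition UB := pres_group ub_rel.
HB.instance Definition _ := Group.on UB.

Definition ub_sigma i : UB := pres_gen ub_rel (GSigma i).
Definition ub_virt i : UB := pres_gen ub_rel (GVirt i).

End UBRel.

Inductive red_gen (n : nat) := RSigma1 | RVirt (i : gen_idx n).
Arguments RSigma1 {n}.

Section ReducedRel.
Variable n : nat.
Implicit Types i j : gen_idx n.
Let s1 : red_gen n * bool := (RSigma1, true).
Let v i : red_gen n * bool := (RVirt i, true).

(* A variable i1, i2 or i3 : gen_idx n constrained to the value 1, 2 or 3
   exists only if that index is at most n - 1, so that the relations with an
   index out of range are left out. *)
Inductive red_rel : word (red_gen n) -> word (red_gen n) -> Prop :=
| red_virt_braid i j : sval j = (sval i).+1 ->
    red_rel [:: v i; v j; v i] [:: v j; v i; v j]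
| red_virt_comm i j : sval j <> (sval i).+1 -> sval i <> (sval j).+1 ->
    red_rel [:: v i; v j] [:: v j; v i]
| red_virt_sq i : red_rel [:: v i; v i] [::]
| red_sigma_virt_comm j : (2 < sval j)%N -> red_rel [:: s1; v j] [:: v j; s1]
| red_braid i1 i2 : sval i1 = 1%N -> sval i2 = 2%N ->
    red_rel
      ([:: v i1; s1; v i1] ++ [:: v i2; s1; v i2] ++ [:: v i1; s1; v i1])
      ([:: v i2; s1; v i2] ++ [:: v i1; s1; v i1] ++ [:: v i2; s1; v i2])
| red_forbidden1 i1 i2 : sval i1 = 1%N -> sval i2 = 2%N ->
    red_rel
      ([:: v i1] ++ [:: v i2; s1; v i2; v i1; s1])
      ([:: v i2; s1; v i2; v i1; s1] ++ [:: v i2])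
| red_forbidden2 i1 i2 : sval i1 = 1%N -> sval i2 = 2%N ->
    red_rel
      ([:: s1; v i1; v i2; s1; v i2] ++ [:: v i1])
      ([:: v i2] ++ [:: s1; v i1; v i2; s1; v i2])
| red_sigma_comm i1 i2 i3 : sval i1 = 1%N -> sval i2 = 2%N -> sval i3 = 3%N ->
    red_rel
      ([:: s1] ++ [:: v i2; v i3; v i1; v i2; s1; v i2; v i1; v i3; v i2])
      ([:: v i2; v i3; v i1; v i2; s1; v i2; v i1; v i3; v i2] ++ [:: s1]).

End ReducedRel.

Definition idx1 (n : nat) (hn : (2 <= n)%N) : gen_idx n := exist _ 1%N hn.

Definition red_to_ub (n : nat) (hn : (2 <= n)%N) (g : red_gen n) : UB n :=
  match g with
  | RSigma1 => ub_sigma (idx1 hn)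
  | RVirt i => ub_virt i
  end.

(* Main.v *)
Require Import Defs.
From mathcomp Require Import all_boot.
From mathcomp Require Import zify.

(** The mixed relation determines every braid generator from its predecessor:
    σ_{i+1} is the conjugate of σ_i by v_{i+1} v_i. So σ_1 and the v_i
    generate UB_n, and the theorem says that the relations of UB_n with small
    indices imply all of them. Homomorphisms in both directions are defined on
    generators; they are mutually inverse because they are so on generators
    ([pres_hom_eq]), and what has to be proved is that each respects the
    relations.

    From the reduced presentation to UB_n: substituting σ_2 and σ_3 by their
    conjugate expressions turns the braid, forbidden and commutation relations
    for σ_1, σ_2, σ_3 into the reduced ones ([conj_braid_iff],
    [conj_forbidden1_iff], [conj_forbidden2_iff], [conj_conjE]).

    Conversely, take a group with a family v satisfying the symmetric group
    relations and an element s commuting with all v_j, j > 2, and define the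
    σ_i from σ_1 = s by the recursion above. First, σ_i commutes with v_j
    whenever |i - j| > 1 ([sigma_of_comm_virt]). Let δ = v_1 v_2 ... v_{n-1}
    be the Coxeter element. Then x -> δ x δ^-1 shifts both families by one
    index, v_i to v_{i+1} and σ_i to σ_{i+1} ([conj_sweep_shift]), so that a
    relation between v_i, v_{i+1}, σ_i, σ_{i+1} need only be known for i = 1
    ([shift_relation]). The commutation of σ_i and σ_j is shifted to i = 1 in
    the same way, and then follows from the case of σ_1 and σ_3 because, from
    j = 3 on, σ_{j+1} is obtained from σ_j by conjugating with virtual
    generators that commute with σ_1 ([sigma_of_comm]).

    Families are indexed by nat from 0 in the proofs: v 0 is v_1, and
    m = n - 1 is the number of virtual generators. *)

Set Implicit Arguments.
Unset Strict Implicit.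
Unset Printing Implicit Defensive.

Local Open Scope group_scope.

(** * Relations rewritten in terms of a conjugate *)

(** Here p, q, r stand for v_1, v_2, v_3 and s for σ_1, so that s ^ (q * p)
    is σ_2. *)
Section ConjugateBraid.
Variables (G : groupType) (p q r s : G).
Hypotheses (pp : p * p = 1) (qq : q * q = 1) (rr : r * r = 1).

Let pV : p^-1 = p. Proof. exact: mulg1_eq. Qed.
Let qV : q^-1 = q. Proof. exact: mulg1_eq. Qed.
Let rV : r^-1 = r. Proof. exact: mulg1_eq. Qed.
Let pK x : x * p * p = x. Proof. by rewrite -mulgA pp mulg1. Qed.

Let conj_qp : s ^ (q * p) = p * q * s * q * p.
Proof. by rewrite conjgE invgM pV qV !mulgA. Qed.

(** The two equations are conjugate to each other by p. *)
Lemma conj_braid_iff :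
  (s * s ^ (q * p) * s = s ^ (q * p) * s * s ^ (q * p)) <->
  (p * s * p) * (q * s * q) * (p * s * p)
    = (q * s * q) * (p * s * p) * (q * s * q).
Proof.
have sp : s ^ p = p * s * p by rewrite conjgE pV mulgA.
have sqpp : (s ^ (q * p)) ^ p = q * s * q.
  by rewrite -conjgM -mulgA pp mulg1 conjgE qV mulgA.
rewrite -sp -sqpp -!conjMg; split=> [-> //|].
exact: conjg_inj.
Qed.

Lemma conj_forbidden1_iff :
  (p * s ^ (q * p) * s = s ^ (q * p) * s * q) <->
  p * (q * s * q * p * s) = (q * s * q * p * s) * q.
Proof.
rewrite conj_qp; split=> e.
  by apply: (mulgI p); rewrite !mulgA in e *.
by apply: (mulgI p); rewrite !mulgA in e *; rewrite pp !mul1g.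
Qed.

Lemma conj_forbidden2_iff :
  (s * s ^ (q * p) * p = q * s * s ^ (q * p)) <->
  (s * p * q * s * q) * p = q * (s * p * q * s * q).
Proof.
rewrite conj_qp; split=> e.
  by apply: (mulIg p); rewrite !mulgA in e *.
by apply: (mulIg p); rewrite !mulgA in e *; rewrite !pK.
Qed.

Lemma conj_conjE :
  (s ^ (q * p)) ^ (r * q) = q * r * p * q * s * q * p * r * q.
Proof. by rewrite !conjgE !invgM pV qV rV !mulgA. Qed.

End ConjugateBraid.

(** * Shifting the generators by a Coxeter element *)

Section Family.
Variables (G : groupType) (m : nat) (v : nat -> G).

Definition shift_rec (x : nat -> G) : Prop :=
  forall i, i.+1 < m -> x i.+1 = x i ^ (v i.+1 * v i).

Definition far_commuting (x : nat -> G) : Prop :=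
  forall i j, i < m -> j < m -> far i j -> commute (x i) (v j).

(** For involutions v i, this is the inverse of the Coxeter element
    v 0 * ... * v k.-1. Conjugating by it amounts to conjugating by v k.-1
    first and by v 0 last. *)
Fixpoint sweep k : G := if k is k'.+1 then v k' * sweep k' else 1.

Lemma conjg_commute (x y : G) : commute x y -> x ^ y = x.
Proof. by move=> xy; rewrite conjgE xy mulKg. Qed.

Lemma conj_sweep_fix x k :
  (forall j, j < k -> commute x (v j)) -> x ^ sweep k = x.
Proof.
elim: k => [|k IHk] xv /=; first exact: conjg1.
rewrite conjgM (conjg_commute (y := v k)) ?IHk//; last exact: xv.
by move=> j jk; apply: xv; apply: leqW.
Qed.

(** In the sweep, the factors v j with j > i.+1 fix x i, the next two carry it
    to x i.+1 by the recursion, and the remaining ones fix x i.+1. *)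
Lemma conj_sweep_shift x i :
  shift_rec x -> far_commuting x -> i.+1 < m -> x i ^ sweep m = x i.+1.
Proof.
move=> xS xv im.
suff H k : i.+1 < k <= m -> x i ^ sweep k = x i.+1 by apply: H; rewrite im /=.
elim: k => // k IHk /andP[ik km] /=.
have [ki|ki] := eqVneq k i.+1.
  rewrite ki /= mulgA conjgM -xS//; apply: conj_sweep_fix => j ji.
  by apply: xv; rewrite ?/far; lia.
rewrite conjgM (conjg_commute (y := v k)) ?IHk//; first by lia.
by apply: xv; rewrite ?/far; lia.
Qed.

Hypotheses
  (v_sq : forall i, i < m -> v i * v i = 1)
  (v_braid : forall i, i.+1 < m -> v i * v i.+1 * v i = v i.+1 * v i * v i.+1)
  (v_comm : far_commuting v).

Lemma virt_invol i : i < m -> (v i)^-1 = v i.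
Proof. by move=> im; apply/mulg1_eq/v_sq. Qed.

(** The braid relation, read as a conjugation. *)
Lemma virt_shift_rec : shift_rec v.
Proof.
move=> i im; have im' := ltnW im.
rewrite conjgE invgM !virt_invol// !mulgA v_braid//.
by rewrite -(mulgA (v i.+1 * v i)) v_sq// mulg1 -mulgA v_sq// mulg1.
Qed.

Fixpoint sigma_of (s : G) k : G :=
  if k is k'.+1 then sigma_of s k' ^ (v k'.+1 * v k') else s.

Variable s : G.
Let a := sigma_of s.

Lemma sigma_of_shift_rec : shift_rec a. Proof. by []. Qed.

Hypothesis s_comm : forall j, 1 < j < m -> commute s (v j).

(** When σ_{i+1} is expressed through σ_i, every factor commutes with v_j,
    except for j = i - 1. In that case σ_{i+1} is expressed through σ_{i-1} as
    a conjugate by w, where w also takes v_{i+1} to v_{i-1}; and v_{i+1}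
    commutes with σ_{i-1}. *)
Lemma sigma_of_comm_virt : far_commuting a.
Proof.
have commJ (x y z : G) : commute x z -> commute y z -> commute (x ^ y) z.
  move=> xz yz; rewrite conjgE; apply/commute_sym; apply: commuteM.
    by apply: commuteV; apply: commute_sym.
  by apply: commuteM; apply: commute_sym.
elim/ltn_ind=> -[|i] IHi j im jm ij.
  by apply: s_comm; move: ij; rewrite /far; lia.
have [ji|nji] := eqVneq i j.+1; last first.
  apply: commJ; first by apply: IHi; move: ij nji; rewrite ?/far; lia.
  apply/commute_sym; apply: commuteM;
    by apply: v_comm; move: ij nji; rewrite ?/far; lia.
rewrite {i}ji in IHi im ij *.
rewrite /a /= -/a -conjgM.
(* As a permutation, w exchanges the blocks {j, j+1} and {j+2, j+3}. *)
set w := _ * (_ * _).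
have jm1 : j.+1 < m by exact: ltnW.
suff -> : v j = v j.+2 ^ w.
  rewrite /commute -!conjMg; congr (_ ^ w).
  by apply: IHi; rewrite ?/far//; lia.
have vSV k : k.+1 < m -> v k.+1 ^ (v k * v k.+1) = v k.
  move=> km; have km' := ltnW km.
  rewrite {1}virt_shift_rec// -conjgM mulgA -(mulgA (v k.+1)) v_sq//.
  by rewrite mulg1 v_sq// conjg1.
have -> : w = (v j.+1 * v j.+2) * (v j * v j.+1).
  rewrite /w -!mulgA; congr (_ * _); rewrite !mulgA; congr (_ * _).
  by apply: v_comm; rewrite /far; lia.
by rewrite conjgM !vSV.
Qed.

Lemma sigma_of_comm :
  (2 < m -> commute (a 0) (a 2)) ->
  forall i j, i < m -> j < m -> far i j -> commute (a i) (a j).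
Proof.
move=> a02.
suff H i j : i.+1 < j < m -> commute (a i) (a j).
  move=> i j im jm /orP[]ij; first by apply: H; rewrite ij.
  by apply/commute_sym/H; rewrite ij.
(* For i > 0, the sweep reduces (i, j) to (i - 1, j - 1). *)
elim: i j => [|i IHi] j /andP[ij jm]; last first.
  case: j ij jm => // j ij jm.
  rewrite -!(conj_sweep_shift sigma_of_shift_rec sigma_of_comm_virt)//;
    last by lia.
  by rewrite /commute -!conjMg IHi//; lia.
elim: j ij jm => // -[|[|j]] IHj // _ jm.
rewrite sigma_of_shift_rec // conjgE.
have c2 : commute (a 0) (v j.+3 * v j.+2).
  by apply: commuteM; apply: s_comm; lia.
by do 2?[apply: commuteM => //]; [apply: commuteV | apply: IHj => //; lia].
Qed.

Lemma sigma_of_mixed i : i.+1 < m -> v i * a i.+1 * v i = v i.+1 * a i * v i.+1.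
Proof.
move=> im; have im' := ltnW im.
rewrite sigma_of_shift_rec// conjgE invgM !virt_invol// !mulgA v_sq// mul1g.
by rewrite -!mulgA v_sq// mulg1.
Qed.

(** Conjugation by the sweep carries the relation from each index to the next. *)
Lemma shift_relation (P : G -> G -> G -> G -> Prop) :
  (forall x y z t g, P x y z t -> P (x ^ g) (y ^ g) (z ^ g) (t ^ g)) ->
  (1 < m -> P (v 0) (v 1) (a 0) (a 1)) ->
  forall i, i.+1 < m -> P (v i) (v i.+1) (a i) (a i.+1).
Proof.
move=> PJ P0; elim=> // i IHi im.
have := PJ _ _ _ _ (sweep m) (IHi (ltnW im)).
rewrite !(conj_sweep_shift virt_shift_rec v_comm) //; try by lia.
by rewrite !(conj_sweep_shift sigma_of_shift_rec sigma_of_comm_virt) //; lia.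
Qed.

End Family.

(** * Homomorphisms out of a presented group *)

Ltac eval_words := rewrite /word_eval /= !big_cons !big_nil /= ?mulg1 ?mulgA.

Section Generation.
Variables (X : Type) (R : word X -> word X -> Prop).

Lemma pres_hom_eq (G : groupType) (phi psi : pres_group R -> G) :
    {morph phi : a b / a * b} -> {morph psi : a b / a * b} ->
    (forall x, phi (pres_gen R x) = psi (pres_gen R x)) ->
  phi =1 psi.
Proof.
move=> phiM psiM gen_eq a.
have one_of (h : pres_group R -> G) : {morph h : a b / a * b} -> h 1 = 1.
  by move=> hM; apply: (mulgI (h 1)); rewrite -hM !mulg1.
have inv_of (h : pres_group R -> G) b : {morph h : a b / a * b} ->
    h b^-1 = (h b)^-1.
  by move=> hM; apply: (mulgI (h b)); rewrite -hM !mulgV one_of.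
have -> : a = word_eval (pres_gen R) (repr a)%qT.
  by rewrite -pres_class_eval; apply/esym/reprK.
elim: (repr a)%qT => [|[x b] w IHw]; rewrite /word_eval.
  by rewrite big_nil !one_of.
rewrite big_cons phiM psiM; congr (_ * _); last exact: IHw.
by case: b => //=; rewrite !inv_of // gen_eq.
Qed.

End Generation.

(** * The two presentations *)

Section Presentations.
Variable m : nat.
Local Notation n := m.+1.

Definition idx k (km : k < m) : gen_idx n := exist _ k.+1 km.

Lemma idx_pred (i : gen_idx n) : exists k (km : k < m), i = idx km.
Proof.
case: i => -[|k] //= km; exists k; exists km.
exact: val_inj.
Qed.

Lemma idx_eq (i j : gen_idx n) : sval i = sval j -> i = j.
Proof. exact: val_inj. Qed.

Definition at_idx (G : groupType) (f : gen_idx n -> G) k : G :=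
  oapp f 1 (insub k.+1).

Lemma at_idxE (G : groupType) (f : gen_idx n -> G) k (km : k < m) :
  at_idx f k = f (idx km).
Proof.
by rewrite /at_idx (insubT (fun i => 0 < i < n)) /=; congr f; apply: val_inj.
Qed.

Lemma ub_virt_invol (i : gen_idx n) : ub_virt i * ub_virt i = 1.
Proof.
by have := pres_group_rel (ub_virt_sq i); eval_words.
Qed.

Lemma ub_sigma_succ (i j : gen_idx n) : sval j = (sval i).+1 ->
  ub_sigma j = ub_sigma i ^ (ub_virt j * ub_virt i).
Proof.
move=> ij; have := pres_group_rel (ub_mixed ij).
rewrite /word_eval !big_cons big_nil /= !mulg1 -/(ub_virt _) -/(ub_virt _).
rewrite -/(ub_sigma _) -/(ub_sigma _) => e.
rewrite conjgE invgM !(mulg1_eq (ub_virt_invol _)).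
apply: (mulgI (ub_virt i)); apply: (mulIg (ub_virt i)).
rewrite !mulgA ub_virt_invol mul1g -!mulgA e.
by rewrite ub_virt_invol mulg1.
Qed.

(** The relations that UB_n does not have verbatim are the trivial commutation
    of v_i with itself and relations of UB_n from which σ_2 and σ_3 have been
    eliminated. *)
Lemma red_rel_in_ub (hn : 1 < n) u w :
  red_rel u w -> word_eval (red_to_ub hn) u = word_eval (red_to_ub hn) w.
Proof.
have s1E (i1 : gen_idx n) : sval i1 = 1%N -> ub_sigma (idx1 hn) = ub_sigma i1.
  by move=> i1E; congr ub_sigma; apply: idx_eq; rewrite i1E.
case=> [i j ij|i j ij ji|i|j j2|i1 i2 e1 e2|i1 i2 e1 e2|i1 i2 e1 e2|
       i1 i2 i3 e1 e2 e3].
- by have := pres_group_rel (ub_virt_braid ij); eval_words.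
- have [/idx_eq-> //|nij] := eqVneq (sval i) (sval j).
  have fij : far (sval i) (sval j) by rewrite /far; lia.
  by have := pres_group_rel (ub_virt_comm fij); eval_words.
- by have := pres_group_rel (ub_virt_sq i); eval_words.
- have f1j : far (sval (idx1 hn)) (sval j) by rewrite /far /=; lia.
  by have := pres_group_rel (ub_mixed_comm f1j); eval_words.
- have e12 : sval i2 = (sval i1).+1 by rewrite e1.
  have := pres_group_rel (ub_braid e12); eval_words.
  rewrite -!/(ub_sigma _) -!/(ub_virt _) (s1E _ e1) (ub_sigma_succ e12).
  by move/(conj_braid_iff _ (ub_virt_invol _) (ub_virt_invol _));
    rewrite !mulgA.
- have e12 : sval i2 = (sval i1).+1 by rewrite e1.
  have := pres_group_rel (ub_forbidden1 e12); eval_words.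
  rewrite -!/(ub_sigma _) -!/(ub_virt _) (s1E _ e1) (ub_sigma_succ e12).
  by move/(conj_forbidden1_iff _ (ub_virt_invol _) (ub_virt_invol _));
    rewrite !mulgA.
- have e12 : sval i2 = (sval i1).+1 by rewrite e1.
  have := pres_group_rel (ub_forbidden2 e12); eval_words.
  rewrite -!/(ub_sigma _) -!/(ub_virt _) (s1E _ e1) (ub_sigma_succ e12).
  by move/(conj_forbidden2_iff _ (ub_virt_invol _) (ub_virt_invol _));
    rewrite !mulgA.
have e12 : sval i2 = (sval i1).+1 by rewrite e1.
have e23 : sval i3 = (sval i2).+1 by rewrite e2.
have e13 : far (sval i1) (sval i3) by rewrite e1 e3.
have := pres_group_rel (ub_sigma_comm e13); eval_words.
rewrite -!/(ub_sigma _) -!/(ub_virt _) (s1E _ e1).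
rewrite (ub_sigma_succ e23) (ub_sigma_succ e12).
rewrite (conj_conjE _ (ub_virt_invol _) (ub_virt_invol _) (ub_virt_invol _)).
by rewrite !mulgA.
Qed.

Let s : pres_group (@red_rel n) := pres_gen (@red_rel n) RSigma1.
Let V k : pres_group (@red_rel n) :=
  at_idx (fun i => pres_gen (@red_rel n) (RVirt i)) k.

Let VE k (km : k < m) : pres_gen (@red_rel n) (RVirt (idx km)) = V k.
Proof. by rewrite /V (at_idxE _ km). Qed.

Let V_sq i : i < m -> V i * V i = 1.
Proof.
move=> im; have := pres_group_rel (red_virt_sq (idx im)); eval_words.
by rewrite VE.
Qed.

Let V_braid i : i.+1 < m -> V i * V i.+1 * V i = V i.+1 * V i * V i.+1.
Proof.
move=> im.
have := pres_group_rel (@red_virt_braid n (idx (ltnW im)) (idx im) erefl);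
  eval_words.
by rewrite !VE.
Qed.

Let V_comm : far_commuting m V V.
Proof.
move=> i j im jm ij.
have := @red_virt_comm n (idx im) (idx jm).
move/(_ _ _)/pres_group_rel; eval_words; rewrite !VE; apply;
  by move: ij; rewrite /far /=; lia.
Qed.

Let s_comm j : 1 < j < m -> commute s (V j).
Proof.
move=> /andP[j1 jm].
have := pres_group_rel (@red_sigma_virt_comm n (idx jm) j1); eval_words.
by rewrite VE.
Qed.

Let A := sigma_of V s.

Let A_comm i j : i < m -> j < m -> far i j -> commute (A i) (A j).
Proof.
apply: sigma_of_comm => // m3; have m2 := ltnW m3; have m1 := ltnW m2.
have := pres_group_rel
  (@red_sigma_comm n (idx m1) (idx m2) (idx m3) erefl erefl erefl);
  eval_words; rewrite !VE -/s => e.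
rewrite /commute /= (conj_conjE _ (V_sq m1) (V_sq m2) (V_sq m3)).
by rewrite !mulgA.
Qed.

Definition ub_to_red (g : ub_gen n) : pres_group (@red_rel n) :=
  match g with
  | GSigma i => A (sval i).-1
  | GVirt i => pres_gen (@red_rel n) (RVirt i)
  end.

Let A_braid i : i.+1 < m -> A i * A i.+1 * A i = A i.+1 * A i * A i.+1.
Proof.
apply: (@shift_relation _ m V _ _ _ s _
  (fun _ _ z t => z * t * z = t * z * t)) => //.
  by move=> _ _ z t g; rewrite -!conjMg => ->.
move=> m2; have m1 := ltnW m2.
apply/(conj_braid_iff _ (V_sq m1) (V_sq m2)).
have := pres_group_rel (@red_braid n (idx m1) (idx m2) erefl erefl);
  eval_words.
by rewrite !VE.
Qed.

Let A_forbidden1 i : i.+1 < m -> V i * A i.+1 * A i = A i.+1 * A i * V i.+1.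
Proof.
apply: (@shift_relation _ m V _ _ _ s _
  (fun x y z t => x * t * z = t * z * y)) => //.
  by move=> x y z t g; rewrite -!conjMg => ->.
move=> m2; have m1 := ltnW m2.
apply/(conj_forbidden1_iff _ (V_sq m1) (V_sq m2)).
have := pres_group_rel (@red_forbidden1 n (idx m1) (idx m2) erefl erefl);
  eval_words.
by rewrite !VE.
Qed.

Let A_forbidden2 i : i.+1 < m -> A i * A i.+1 * V i = V i.+1 * A i * A i.+1.
Proof.
apply: (@shift_relation _ m V _ _ _ s _
  (fun x y z t => z * t * x = y * z * t)) => //.
  by move=> x y z t g; rewrite -!conjMg => ->.
move=> m2; have m1 := ltnW m2.
apply/(conj_forbidden2_iff _ (V_sq m1) (V_sq m2)).
have := pres_group_rel (@red_forbidden2 n (idx m1) (idx m2) erefl erefl);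
  eval_words.
by rewrite !VE.
Qed.

(** The mixed relation holds by construction of the σ_i, and the purely virtual
    relations belong to both presentations; all others come down to their
    instances involving σ_1. *)
Lemma ub_rel_in_red u w :
  ub_rel u w -> word_eval ub_to_red u = word_eval ub_to_red w.
Proof.
case=> [i j|i j|i|i j|i j|i j|i j|i j|i j];
  eval_words;
  have [k [km ->]] := idx_pred i;
  try have [l [lm ->]] := idx_pred j; rewrite /= ?VE.
- by case=> ?; subst l; apply: A_braid.
- exact: (A_comm km lm).
- exact: V_sq.
- by case=> ?; subst l; apply: V_braid.
- exact: (V_comm km lm).
- exact: (sigma_of_comm_virt V_sq V_braid V_comm s_comm km lm).
- by case=> ?; subst l; apply: (sigma_of_mixed V_sq).
- by case=> ?; subst l; apply: A_forbidden1.
- by case=> ?; subst l; apply: A_forbidden2.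
Qed.

End Presentations.

Theorem theorem6 (n : nat) (hn : (2 <= n)%N) :
  has_presentation (G := UB n) (red_to_ub hn) (@red_rel n).
Proof.
case: n hn => // m hn.
have [phi phiE] := pres_group_lift (@red_rel_in_ub m hn).
have [psi psiE] := pres_group_lift (@ub_rel_in_red m).
have morphJ x y : phi (x ^ y) = phi x ^ phi y.
  by apply: (mulgI (phi y)); rewrite -gmulfM -!conjgC gmulfM.
exists phi; split=> //; exists psi.
  apply: (@pres_hom_eq _ _ _ (psi \o phi) id) => //.
    by move=> a b /=; rewrite !gmulfM.
  case=> [|i] /=; rewrite phiE; exact: psiE.
apply: (@pres_hom_eq _ _ _ (phi \o psi) id) => //.
  by move=> a b /=; rewrite !gmulfM.
case=> i /=; rewrite psiE /=; last exact: phiE.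
(* It remains to recognise the recursively defined elements as the σ_i of
   UB_n: by the mixed relation, these obey the same recursion. *)
have [k [km ->]] := idx_pred i; rewrite /=.
elim: k km => [|k IHk] km /=.
  by rewrite phiE /=; congr ub_sigma; apply: idx_eq.
have km' := ltnW km.
rewrite morphJ gmulfM (IHk km') !(at_idxE _ km) !(at_idxE _ km') !phiE /=.
by rewrite -(@ub_sigma_succ m (idx km') (idx km)).
Qed.
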